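(* Let $E$ be a symmetric operator defined on a dense domain $\mathcal D$ of a Hilbert space $\mathcal H$. Let $\mathbf d=\{d_i\}_{i\in\mathbb N}$ and $\boldsymbol\lambda=\{\lambda_i\}_{i\in\mathbb N}$ be nondecreasing unbounded real sequences such that \[ \delta_k:=\sum_{i=1}^k(d_i-\lambda_i)\ge0\qquad\text{for all }k\in\mathbb N. \] Assume that $\delta_k<\alpha:=\liminf_{i\to\infty}\delta_i$ for infinitely many $k$. If $\{f_i\}_{i\in\mathbb N}\subset\mathcal D$ is an orthonormal sequence with $\langle Ef_i,f_i\rangle=\lambda_i$ for all $i$, then there exists an orthonormal sequence $\{e_i\}_{i\in\mathbb N}$, each element of which lies in the (algebraic) linear span of $\{f_i\}_{i\in\mathbb N}$, such that $\overline{\operatorname{span}}\{e_i\}=\overline{\operatorname{span}}\{f_i\}$ and $\langle Ee_i,e_i\rangle=d_i$ for all $i\in\mathbb N$.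
   Context: $E$ symmetric means $\langle Ef,g\rangle=\langle f,Eg\rangle$ for all $f,g\in\mathcal D$. $\overline{\operatorname{span}}$ is the closed linear span. *)

(* Defs.v *)
From HB Require Import structures.
From mathcomp Require Import all_boot all_order all_algebra.
From mathcomp Require Import complex.
From mathcomp Require Import all_classical all_reals.
From mathcomp Require Import ereal sequences.
Set Implicit Arguments. Unset Strict Implicit. Unset Printing Implicit Defensive.
Import Order.TTheory GRing.Theory Num.Theory.
Local Open Scope ring_scope.
Local Open Scope classical_set_scope.

Section Hilbert.
Variable R : realType.
Variable V : lmodType R[i].
(* ip x y: linear in x, conjugate-linear in y *)
Variable ip : V -> V -> R[i].

Definition is_inner_product : Prop :=
  [/\ (forall (a : R[i]) (x y z : V), ip (a *: x + y) z = a * ip x z + ip y z),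
      (forall x y : V, ip y x = conjc (ip x y)),
      (forall x : V, 0 <= complex.Re (ip x x)) &
      (forall x : V, complex.Re (ip x x) = 0 -> x = 0)].

Definition hnorm (x : V) : R := Num.sqrt (complex.Re (ip x x)).

Definition ip_complete : Prop :=
  forall u : nat -> V,
    (forall e : R, 0 < e -> exists N : nat, forall m n : nat,
        (N <= m)%N -> (N <= n)%N -> hnorm (u m - u n) < e) ->
    exists l : V, forall e : R, 0 < e -> exists N : nat, forall n : nat,
        (N <= n)%N -> hnorm (u n - l) < e.

Definition is_hilbert : Prop := is_inner_product /\ ip_complete.

Definition hclosure (A : set V) : set V :=
  [set x | forall e : R, 0 < e -> exists y, A y /\ hnorm (x - y) < e].

Definition hdense (A : set V) : Prop := forall x, hclosure A x.

Definition is_subspace (D : set V) : Prop :=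
  D 0 /\ forall (a : R[i]) (x y : V), D x -> D y -> D (a *: x + y).

Definition lspan (f : nat -> V) : set V :=
  [set x | exists (n : nat) (c : nat -> R[i]), x = \sum_(j < n) c j *: f j].

Definition cspan (f : nat -> V) : set V := hclosure (lspan f).

Definition horthonormal (f : nat -> V) : Prop :=
  forall i j : nat, ip (f i) (f j) = (i == j)%:R.

(* E : D -> V linear operator with domain D (given as a total function,
   only its values on D matter) which is symmetric *)
Definition hsymmetric_op (D : set V) (E : V -> V) : Prop :=
  (forall (a : R[i]) (x y : V), D x -> D y -> E (a *: x + y) = a *: E x + E y) /\
  (forall f g : V, D f -> D g -> ip (E f) g = ip f (E g)).

End Hilbert.

Definition nondecr_seq (R : realType) (u : nat -> R) : Prop :=
  forall i j : nat, (i <= j)%N -> u i <= u j.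

Definition unbounded_seq (R : realType) (u : nat -> R) : Prop :=
  forall M : R, exists i : nat, M < u i.

(* delta k = sum_{i=1}^{k+1} (d_i - lambda_i)  (0-based indexing: the paper's
   index i corresponds to i-1 here) *)
Definition delta (R : realType) (d lam : nat -> R) (k : nat) : R :=
  \sum_(i < k.+1) (d i - lam i).

(* Main.v *)
(* Call <E x, x> the value of a unit vector x. In the plane of two orthonormal
   vectors with values a <= b, a rotation with a suitable phase gives any value
   of [a, b] to one vector and the complementary value to the other;
   by induction this yields the finite Schur-Horn theorem for sorted sequences.
   For the infinite problem, the condition on the liminf makes every tail of
   delta attain its minimum, so N splits into consecutive blocks such that delta
   never drops below its value at the end of the previous block. The sum of d
   over a block exceeds that of lambda by a surplus. The surpluses come from
   infinity: the last vector of each block is rotated against the last vector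
   of the next block, which may be taken with a far larger value because lambda
   is unbounded. Large gaps keep the leftover coefficients of this chain below
   1/sqrt 2, so their products tend to 0 and the closed span is preserved. Each
   block then satisfies the hypotheses of the finite theorem. *)
Require Import Defs.
From HB Require Import structures.
From mathcomp Require Import all_boot all_order all_algebra.
From mathcomp Require Import complex.
From mathcomp Require Import all_classical all_reals.
From mathcomp Require Import ereal sequences topology normedtype.
From mathcomp Require Import zify ring lra.
Import Order.TTheory GRing.Theory Num.Theory.
Local Open Scope ring_scope.
Local Open Scope classical_set_scope.

Set Implicit Arguments.
Unset Strict Implicit.
Unset Printing Implicit Defensive.

(** * Algebraic spans *)

Section Span.
Variables (R : realType) (V : lmodType R[i]).
Implicit Types (W S T : set V) (x y : V).

(** Taken as the intersection of all subspaces containing [S], so that membership is used by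
    exhibiting a subspace, without coefficients. *)
Definition hspan S : set V :=
  [set x | forall W, is_subspace W -> S `<=` W -> W x].

Lemma subspaceD W x y : is_subspace W -> W x -> W y -> W (x + y).
Proof. by case=> _ H Wx Wy; rewrite -[x]scale1r; exact: H. Qed.

Lemma subspaceZ W (a : R[i]) x : is_subspace W -> W x -> W (a *: x).
Proof. by case=> W0 H Wx; rewrite -[_ *: _]addr0; exact: H. Qed.

Lemma hspan_subspace S : is_subspace (hspan S).
Proof.
split=> [W [W0 _] _ //|a x y Sx Sy W Wsub SW].
by case: (Wsub) => _; apply; [exact: Sx|exact: Sy].
Qed.

Lemma sub_hspan S : S `<=` hspan S.
Proof. by move=> x Sx W _; apply. Qed.

Lemma hspan_sub S W : is_subspace W -> S `<=` W -> hspan S `<=` W.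
Proof. by move=> Wsub SW x; apply. Qed.

Lemma hspanS S T : S `<=` T -> hspan S `<=` hspan T.
Proof.
move=> ST; apply: hspan_sub; first exact: hspan_subspace.
by move=> x /ST; exact: sub_hspan.
Qed.

Lemma lspan_subspace (f : nat -> V) : is_subspace (lspan f).
Proof.
split; first by exists 0%N, (fun=> 0); rewrite big_ord0.
move=> a x y [m [b ->]] [n [c ->]].
(* The two combinations may have different lengths; both are padded with zeros to length [m + n]. *)
exists (m + n)%N,
  (fun j => a * (if (j < m)%N then b j else 0) +
            (if (j < n)%N then c j else 0)).
have extend p (g : nat -> R[i]) : (p <= m + n)%N ->
    \sum_(j < p) g j *: f j =
    \sum_(j < m + n) (if (j < p)%N then g j else 0) *: f j.
  move=> pmn; rewrite (big_ord_widen _ (fun j => g j *: f j) pmn) big_mkcond /=.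
  by apply: eq_bigr => j _; case: ifP => // _; rewrite scale0r.
rewrite (extend m) ?leq_addr// (extend n) ?leq_addl// scaler_sumr -big_split /=.
by apply: eq_bigr => j _; rewrite scalerDl scalerA.
Qed.

Lemma mem_lspan (f : nat -> V) i : lspan f (f i).
Proof.
exists i.+1, (fun j => (j == i)%:R); rewrite big_ord_recr /= eqxx scale1r.
rewrite big1 ?add0r// => j _.
by rewrite (ltn_eqF (ltn_ord j)) scale0r.
Qed.

Lemma lspanE (f : nat -> V) : lspan f = hspan (range f).
Proof.
apply/seteqP; split.
  move=> _ [n [c ->]] W Wsub fW; elim/big_ind: _ => [|x y|j _].
  - by case: Wsub.
  - exact: subspaceD.
  - by apply: subspaceZ => //; apply: fW; exists (val j).
apply: hspan_sub; first exact: lspan_subspace.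
by move=> _ [i _ <-]; exact: mem_lspan.
Qed.

End Span.

(** * Inner products, orthogonality and closures *)

Section InnerProduct.
Variables (R : realType) (V : lmodType R[i]) (ip : V -> V -> R[i]).
Hypothesis Hip : is_inner_product ip.
Implicit Types (W S T A : set V) (x y : V).

Lemma ip_conj x y : ip y x = conjc (ip x y).
Proof. by case: Hip. Qed.

Lemma ipDl x y z : ip (x + y) z = ip x z + ip y z.
Proof. by case: Hip => H _ _ _; rewrite -{1}[x]scale1r H mul1r. Qed.

Lemma ip0l z : ip 0 z = 0.
Proof. by have := ipDl 0 0 z; rewrite addr0 -{1}[ip _ _]addr0 => /addrI. Qed.

Lemma ipZl a x z : ip (a *: x) z = a * ip x z.
Proof. by case: Hip => H _ _ _; rewrite -{1}[a *: x]addr0 H ip0l addr0. Qed.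

Lemma ipDr x y z : ip z (x + y) = ip z x + ip z y.
Proof. by rewrite ip_conj ipDl rmorphD /= -!ip_conj. Qed.

Lemma ipZr a x z : ip z (a *: x) = conjc a * ip z x.
Proof. by rewrite ip_conj ipZl rmorphM /= -!ip_conj. Qed.

Lemma ip_sym0 x y : ip x y = 0 -> ip y x = 0.
Proof. by rewrite (ip_conj x y) => ->; rewrite rmorph0. Qed.

Lemma orth_subspace (S : set V) :
  is_subspace [set x | forall y, S y -> ip x y = 0].
Proof.
split=> [y _|a x y Sx Sy z Sz]; first exact: ip0l.
by rewrite ipDl ipZl Sx // Sy // mulr0 addr0.
Qed.

(** The vectors orthogonal to a given set form a subspace; this is applied to each argument in turn,
    with a conjugation to swap them. *)
Lemma hspan_orth (S T : set V) x y :
  (forall u v, S u -> T v -> ip u v = 0) ->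
  hspan S x -> hspan T y -> ip x y = 0.
Proof.
move=> ST Sx Ty; apply: ip_sym0.
apply: (hspan_sub (orth_subspace [set x]) _ Ty) => // v Tv _ ->; apply: ip_sym0.
by apply: (hspan_sub (orth_subspace [set v]) _ Sx) => // u Su _ ->; exact: ST.
Qed.

Definition sqn x : R := complex.Re (ip x x).

Lemma sqn_ge0 x : 0 <= sqn x.
Proof. by case: Hip => _ _ + _; apply. Qed.

Lemma ip_sqn x : ip x x = ((sqn x)%:C)%C.
Proof.
have := ip_conj x x; rewrite /sqn; case: (ip x x) => a b [bNb].
by congr Complex => /=; lra.
Qed.

Lemma conjc_mul (z : R[i]) :
  z * conjc z = ((complex.Re z ^+ 2 + complex.Im z ^+ 2)%:C)%C.
Proof. by rewrite add_Re2_Im2 sqr_normc. Qed.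

Lemma sqnZ (a : R[i]) x :
  sqn (a *: x) = (complex.Re a ^+ 2 + complex.Im a ^+ 2) * sqn x.
Proof.
rewrite {1}/sqn ipZl ipZr mulrA conjc_mul ip_sqn.
by rewrite -rmorphM.
Qed.

(** The parallelogram law with the term of the difference dropped; it serves as a triangle
    inequality without square roots. *)
Lemma sqnD_le x y : sqn (x + y) <= 2 * sqn x + 2 * sqn y.
Proof.
suff : sqn (x + y) + sqn (x + (- 1) *: y) = 2 * sqn x + 2 * sqn y.
  by have := sqn_ge0 (x + (- 1) *: y); lra.
rewrite /sqn !ipDl !ipDr !ipZl !ipZr rmorphN1 /=.
case: (ip x x) (ip x y) (ip y x) (ip y y) => [a a'] [b b'] [c c'] [e e'] /=.
rewrite /=; ring.
Qed.

Lemma hclosureP A x :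
  hclosure ip A x <-> forall e : R, 0 < e -> exists y, A y /\ sqn (x - y) < e.
Proof.
split=> H e e0.
  have [|y [Ay xy]] := H (Num.sqrt e); first by rewrite sqrtr_gt0.
  by exists y; split=> //; rewrite -ltr_sqrt.
have [|y [Ay xy]] := H (e ^+ 2); first by rewrite exprn_gt0.
exists y; split => //; rewrite /hnorm.
rewrite -(ltr_pXn2r (_ : 0 < 2)%N) ?nnegrE ?sqrtr_ge0 ?ltW//.
by rewrite sqr_sqrtr //; exact: sqn_ge0.
Qed.

Lemma hclosureS A B : A `<=` B -> hclosure ip A `<=` hclosure ip B.
Proof.
move=> AB x Ax e e0; have [y [Ay xy]] := Ax e e0.
by exists y; split=> //; exact: AB.
Qed.

Lemma sub_hclosure A : A `<=` hclosure ip A.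
Proof.
move=> x Ax; apply/hclosureP => e e0; exists x; split=> //.
by rewrite subrr /sqn ip0l.
Qed.

Lemma hclosure_idem A : hclosure ip (hclosure ip A) `<=` hclosure ip A.
Proof.
move=> x /hclosureP Ax; apply/hclosureP => e e0.
have [|y [/hclosureP Ay xy]] := Ax (e / 4); first by lra.
have [|z [Az yz]] := Ay (e / 4); first by lra.
exists z; split=> //; rewrite -(subrK y x) -addrA.
by apply: le_lt_trans (sqnD_le _ _) _; lra.
Qed.

Lemma hclosure_subspace A : is_subspace A -> is_subspace (hclosure ip A).
Proof.
move=> Asub; split; first by apply: sub_hclosure; case: Asub.
move=> a x y /hclosureP Ax /hclosureP Ay; apply/hclosureP => e e0.
pose t := complex.Re a ^+ 2 + complex.Im a ^+ 2.
have t0 : 0 <= t by rewrite addr_ge0 ?sqr_ge0.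
(* [t + 1] keeps the denominator positive when [a] is zero; the 4 allows for the two terms and the
   factor 2 of [sqnD_le]. *)
have [|x' [Ax' xx]] := Ax (e / (4 * (t + 1))).
  by apply: divr_gt0 => //; lra.
have [|y' [Ay' yy]] := Ay (e / 4); first by lra.
exists (a *: x' + y'); split; first by case: Asub => _; apply.
rewrite opprD addrACA -scalerBr.
apply: le_lt_trans (sqnD_le _ _) _; rewrite sqnZ -/t.
have : t * sqn (x - x') <= e / 4.
  have : sqn (x - x') * (t + 1) < e / 4.
    rewrite -ltr_pdivlMr; last by lra.
    by move: xx; rewrite invfM mulrA.
  by have := sqn_ge0 (x - x'); nra.
lra.
Qed.

End InnerProduct.

(** * A phase factor, tail minima and the cutting into blocks *)

Lemma phase_Re0 (R : realType) (z : R[i]) :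
  exists w : R[i], w * conjc w = 1 /\ complex.Re (conjc w * z) = 0.
Proof.
case: z => p q; have [r0|r0] := eqVneq (p ^+ 2 + q ^+ 2) 0.
  exists 1; rewrite rmorph1 mulr1 mul1r /=; split=> //.
  by have := sqr_ge0 q; have := sqr_ge0 p; nra.
have r_ge0 : 0 <= p ^+ 2 + q ^+ 2 by rewrite addr_ge0 ?sqr_ge0.
set r := Num.sqrt (p ^+ 2 + q ^+ 2).
have r2 : r ^+ 2 = p ^+ 2 + q ^+ 2 by rewrite sqr_sqrtr.
have rn0 : r != 0 by rewrite -sqrf_eq0 r2.
(* This is [-i z / |z|], so [conjc w * z] equals [i |z|]. *)
exists (Complex (q / r) (- p / r)); split; last by rewrite /=; field.
rewrite conjc_mul /= -[RHS]/((1 : R)%:C)%C; congr (_ %:C)%C.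
by rewrite !expr_div_n r2; field; rewrite -r2 expf_neq0.
Qed.

(** The liminf is the supremum of the tail infima, so a value [u k0] below it is exceeded by every
    term from some [M] on. Only finitely many indices then compete for the minimum. *)
Lemma liminf_tail_min (R : realType) (u : nat -> R) :
  (forall N : nat, exists k : nat, (N <= k)%N /\
     ((u k)%:E < limn_einf (fun i => (u i)%:E))%E) ->
  forall N, exists2 k, (N <= k)%N & forall i, (N <= i)%N -> u k <= u i.
Proof.
move=> H N.
have [k0 [Nk0]] := H N; rewrite limn_einf_lim.
rewrite (cvg_lim (@ereal_hausdorff R) (@cvg_einfs_sup R _)).
move=> /ereal_sup_gt[_ [M _ <-] k0M].
have tail i : (M <= i)%N -> u k0 < u i.
  move=> Mi; rewrite -lte_fin; apply: lt_le_trans k0M _.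
  by apply: ereal_inf_lbound; exists i.
(* The window contains [k0], and every index beyond it is past [M]. *)
have [k [Nk kmin]] : exists k, (N <= k)%N /\
    forall i, (N <= i <= N + (M + k0))%N -> u k <= u i.
  elim: (M + k0)%N => [|n [k [Nk kmin]]].
    exists N; split=> // i Ni; have -> // : i = N by lia.
  have [kn|nk] := leP (u k) (u (N + n.+1)%N).
    exists k; split=> // i Ni.
    have [->//|iNn] := eqVneq i (N + n.+1)%N; apply: kmin; lia.
  exists (N + n.+1)%N; split=> [|i Ni]; first by lia.
  have [->//|iNn] := eqVneq i (N + n.+1)%N.
  by apply: le_trans (ltW nk) _; apply: kmin; lia.
exists k => // i Ni; have [iM|Mi] := leqP i (N + (M + k0)).
  by apply: kmin; lia.
apply: le_trans (ltW (tail i _)); last by lia.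
by apply: kmin; lia.
Qed.

(** Each new cut is placed right after a minimiser of [delta] over a far tail. Going far enough
    makes [lam] at the end of a block exceed its value at the end of the previous block by at least
    twice the surplus there, the gap that [raise_chain] requires. *)
Lemma block_decomposition (R : realType) (d lam : nat -> R) :
  let S m := \sum_(i < m) (d i - lam i) in
  nondecr_seq lam -> unbounded_seq lam ->
  (forall k, 0 <= delta d lam k) ->
  (forall N, exists2 k, (N <= k)%N &
     forall i, (N <= i)%N -> delta d lam k <= delta d lam i) ->
  exists a : nat -> nat,
    [/\ a 0%N = 0%N, forall j, (a j < a j.+1)%N,
        forall j m, (a j <= m)%N -> S (a j) <= S m &
        forall j, lam (a j).-1 + 2 * S (a j) <= lam (a j.+1).-1].
Proof.
move=> S lam_le lam_unb delta_ge0 tail_min.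
have next p : exists q, [/\ (p < q)%N, forall m, (q <= m)%N -> S q <= S m &
    lam p.-1 + 2 * S p <= lam q.-1].
  have [N Nlt] := lam_unb (lam p.-1 + 2 * S p).
  have [k Nk kmin] := tail_min (p + N)%N.
  (* [S k.+1] is [delta d lam k], hence the shift by one. *)
  exists k.+1; split; first by lia.
  - by case=> // m km; apply: kmin; lia.
  - by apply: le_trans (ltW Nlt) _; apply: lam_le => /=; lia.
have [nx nxP] := choice next.
exists (fun j => iter j nx 0%N); split=> //.
- by move=> j; rewrite iterS; case: (nxP (iter j nx 0%N)).
- case=> [|j] m /= jm; last by case: (nxP (iter j nx 0%N)) => _ + _; apply.
  rewrite {1}/S big_ord0; case: m jm => [|m] _; first by rewrite /S big_ord0.
  exact: delta_ge0.
- by move=> j; rewrite iterS; case: (nxP (iter j nx 0%N)).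
Qed.

Lemma block_index (a : nat -> nat) :
  a 0%N = 0%N -> (forall j, (a j < a j.+1)%N) ->
  exists blk : nat -> nat, forall i j, (a j <= i < a j.+1)%N = (blk i == j).
Proof.
move=> a0 a_lt.
have a_mono j k : (j < k)%N -> (a j.+1 <= a k)%N.
  elim: k => // k IHk; rewrite ltnS leq_eqVlt => /orP[/eqP->//|/IHk].
  by have := a_lt k; lia.
have ex i : exists j, (a j <= i < a j.+1)%N.
  elim: i => [|i [j jP]]; first by exists 0%N; have := a_lt 0%N; lia.
  have [ij|ij] := ltnP i.+1 (a j.+1); first by exists j; lia.
  by exists j.+1; have := a_lt j.+1; lia.
have [blk blkP] := choice ex.
exists blk => i j; have := blkP i.
by case: (ltngtP (blk i) j) => [/a_mono|/a_mono|<-//]; lia.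
Qed.

(** * Plane rotations, the finite theorem and the infinite chain *)

Section Operator.
Variables (R : realType) (V : lmodType R[i]) (ip : V -> V -> R[i]).
Variables (D : set V) (E : V -> V).
Hypothesis Hip : is_inner_product ip.
Hypothesis HD : is_subspace D.
Hypothesis HE : hsymmetric_op ip D E.
Implicit Types (x y u v : V) (a b t : R).

Lemma opD x y : D x -> D y -> E (x + y) = E x + E y.
Proof.
by move=> Dx Dy; case: HE => H _; rewrite -{1}[x]scale1r H // scale1r.
Qed.

Lemma op0 : E 0 = 0.
Proof.
have D0 : D 0 by case: HD.
by have := opD D0 D0; rewrite addr0 -{1}[E 0]addr0 => /addrI.
Qed.

Lemma opZ (c : R[i]) x : D x -> E (c *: x) = c *: E x.
Proof.
move=> Dx; have D0 : D 0 by case: HD.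
by case: HE => H _; rewrite -{1}[c *: x]addr0 H // op0 addr0.
Qed.

Lemma op_conj x y : D x -> D y -> ip (E y) x = conjc (ip (E x) y).
Proof. by move=> Dx Dy; case: HE => _ H; rewrite H // (ip_conj Hip). Qed.

(** The mutual memberships say that both pairs span the same plane. *)
Definition rotated x y u v a b : Prop :=
  [/\ hspan [set x; y] u /\ hspan [set x; y] v,
      hspan [set u; v] x /\ hspan [set u; v] y,
      [/\ ip u u = 1, ip v v = 1 & ip u v = 0] &
      ip (E u) u = (a%:C)%C /\ ip (E v) v = (b%:C)%C].

(* The phase of [y] is adjusted so that the cross term [ip (E x) y] becomes
   purely imaginary; the real rotation of angle [arcsin (sqrt t)] then
   interpolates linearly between the two diagonal values. *)
Lemma rotation x y a b t : D x -> D y ->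
  ip x x = 1 -> ip y y = 1 -> ip x y = 0 ->
  ip (E x) x = (a%:C)%C -> ip (E y) y = (b%:C)%C -> 0 <= t <= 1 ->
  exists u v, rotated x y u v ((1 - t) * a + t * b) (t * a + (1 - t) * b) /\
    exists c s : R, x = (c%:C)%C *: u + (s%:C)%C *: v /\ s ^+ 2 = t.
Proof.
move=> Dx Dy xx yy xy Exx Eyy /andP[t0 t1].
have [w [ww Rew]] := phase_Re0 (ip (E x) y).
have [z zE] : {z | z = w *: y} by exists (w *: y).
have Dz : D z by rewrite zE; exact: subspaceZ.
have yz : y = conjc w *: z by rewrite zE scalerA mulrC ww scale1r.
have zz : ip z z = 1 by rewrite zE (ipZl Hip) (ipZr Hip) yy mulr1.
have xz : ip x z = 0 by rewrite zE (ipZr Hip) xy mulr0.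
have zx : ip z x = 0 by exact: ip_sym0.
have Ezz : ip (E z) z = (b%:C)%C.
  by rewrite zE opZ // (ipZl Hip) (ipZr Hip) Eyy mulrA ww mul1r.
(* By symmetry of [E] the sum is twice the real part of [conjc w * ip (E x) y], which vanishes by
   the choice of [w]. *)
have Ecross : ip (E x) z + ip (E z) x = 0.
  rewrite (op_conj Dx Dz) zE (ipZr Hip) -[LHS]/(_ + conjc _).
  by rewrite addcJ Rew mulr0.
have sxy (p q : R[i]) : hspan [set x; y] (p *: x + q *: z).
  have Hxy := hspan_subspace [set x; y].
  rewrite zE; apply: (subspaceD Hxy); apply: (subspaceZ _ Hxy).
    by apply: sub_hspan; left.
  by apply: (subspaceZ _ Hxy); apply: sub_hspan; right.
have [c c2] : exists c : R, c ^+ 2 = 1 - t.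
  by exists (Num.sqrt (1 - t)); rewrite sqr_sqrtr // subr_ge0.
have [s s2] : exists s : R, s ^+ 2 = t.
  by exists (Num.sqrt t); rewrite sqr_sqrtr.
have ipuv (p q p' q' : R) :
    ip ((p%:C)%C *: x + (q%:C)%C *: z) ((p'%:C)%C *: x + (q'%:C)%C *: z) =
    ((p * p' + q * q')%:C)%C.
  rewrite !(ipDl Hip, ipDr Hip, ipZl Hip, ipZr Hip) !conjc_real xx zz xz zx.
  by rewrite rmorphD !rmorphM /=; ring.
have Eipuv (p q : R) :
    ip (E ((p%:C)%C *: x + (q%:C)%C *: z)) ((p%:C)%C *: x + (q%:C)%C *: z) =
    ((p ^+ 2 * a + q ^+ 2 * b)%:C)%C.
  rewrite opD; [|exact: subspaceZ|exact: subspaceZ]; rewrite !opZ //.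
  rewrite !(ipDl Hip, ipDr Hip, ipZl Hip, ipZr Hip) !conjc_real Exx Ezz.
  move/eqP: Ecross; rewrite addr_eq0 => /eqP ->.
  rewrite !expr2 rmorphD !rmorphM /=.
  move: (p%:C)%C (q%:C)%C (a%:C)%C (b%:C)%C (ip (E z) x) => {}p {}q A B C.
  by ring.
pose u := (c%:C)%C *: x + (s%:C)%C *: z.
pose v := ((- s)%:C)%C *: x + (c%:C)%C *: z.
have lin (p q : R) : (p%:C)%C *: u + (q%:C)%C *: v =
    ((p * c - q * s)%:C)%C *: x + ((p * s + q * c)%:C)%C *: z.
  rewrite /u /v !scalerDr !scalerA addrACA -!scalerDl -!rmorphM -!rmorphD /=.
  by rewrite mulrN.
have xuv : x = (c%:C)%C *: u + ((- s)%:C)%C *: v.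
  rewrite lin.
  have -> : c * c - - s * s = 1 by rewrite mulNr opprK -!expr2 c2 s2 subrK.
  have -> : c * s + - s * c = 0 by rewrite mulNr mulrC subrr.
  by rewrite rmorph1 rmorph0 scale1r scale0r addr0.
have zuv : z = (s%:C)%C *: u + (c%:C)%C *: v.
  rewrite lin.
  have -> : s * s + c * c = 1 by rewrite -!expr2 c2 s2 addrC subrK.
  have -> : s * c - c * s = 0 by rewrite mulrC subrr.
  by rewrite rmorph1 rmorph0 scale1r scale0r add0r.
have suv (p q : R[i]) : hspan [set u; v] (p *: u + q *: v).
  have Huv := hspan_subspace [set u; v].
  by apply: (subspaceD Huv); apply: (subspaceZ _ Huv); apply: sub_hspan;
    [left|right].
exists u, v; split.
  split.
  - by split; exact: sxy.
  - split; first by have := suv (c%:C)%C ((- s)%:C)%C; rewrite -xuv.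
    rewrite yz; apply: (subspaceZ _ (hspan_subspace _)).
    by have := suv (s%:C)%C (c%:C)%C; rewrite -zuv.
  - split; rewrite ipuv.
    + by rewrite -!expr2 c2 s2 subrK.
    + by rewrite mulrNN -!expr2 c2 s2 addrC subrK.
    + by rewrite mulrN mulrC addNr.
  - by split; rewrite Eipuv ?sqrrN c2 s2.
by exists c, (- s); rewrite sqrrN.
Qed.

Lemma rotation_to x y a b r : D x -> D y ->
  ip x x = 1 -> ip y y = 1 -> ip x y = 0 ->
  ip (E x) x = (a%:C)%C -> ip (E y) y = (b%:C)%C -> a <= r <= b ->
  exists u v, rotated x y u v r (a + b - r).
Proof.
move=> Dx Dy xx yy xy Exx Eyy /andP[ar rb].
(* Solves [(1 - t) * a + t * b = r]. If [a = b], then [r] equals both and the parameter 0 serves. *)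
pose t := (r - a) / (b - a).
have [ab|ab] := eqVneq a b.
  have t01 : 0 <= (0 : R) <= 1 by rewrite lexx ler01.
  have [u [v [H _]]] := rotation Dx Dy xx yy xy Exx Eyy t01.
  by exists u, v; congr (rotated x y u v _ _): H; lra.
have ba : 0 < b - a by rewrite subr_gt0 lt_neqAle ab (le_trans ar).
have t01 : 0 <= t <= 1.
  by rewrite divr_ge0 ?subr_ge0 ?(le_trans ar) //= ler_pdivrMr // mul1r lerB.
have [u [v [H _]]] := rotation Dx Dy xx yy xy Exx Eyy t01.
have bn0 : b - a != 0 by rewrite gt_eqF.
by exists u, v; congr (rotated x y u v _ _): H; rewrite /t; field.
Qed.

(* Induction on [n]: [d 0] lies between two consecutive values [mu p] and
   [mu p.+1]; rotating [f p] and [f p.+1] splits off a vector with value [d 0]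
   and leaves one with value [mu p + mu p.+1 - d 0], so the remaining values
   are again sorted and again majorize the remaining targets. *)
Lemma horn_finite n (f : nat -> V) (mu d : nat -> R) :
  (forall i, (i < n)%N -> D (f i)) ->
  (forall i j, (i < n)%N -> (j < n)%N -> ip (f i) (f j) = (i == j)%:R) ->
  (forall i, (i < n)%N -> ip (E (f i)) (f i) = ((mu i)%:C)%C) ->
  (forall i j, (i <= j < n)%N -> mu i <= mu j) ->
  (forall i j, (i <= j < n)%N -> d i <= d j) ->
  (forall m, (m <= n)%N -> \sum_(i < m) mu i <= \sum_(i < m) d i) ->
  \sum_(i < n) mu i = \sum_(i < n) d i ->
  exists e : nat -> V,
    [/\ forall i j, (i < n)%N -> (j < n)%N -> ip (e i) (e j) = (i == j)%:R,
        forall i, (i < n)%N -> hspan (f @` `I_n) (e i),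
        forall i, (i < n)%N -> hspan (e @` `I_n) (f i) &
        forall i, (i < n)%N -> ip (E (e i)) (e i) = ((d i)%:C)%C].
Proof.
elim: n f mu d => [|n IHn] f mu d Df ipf Ef mu_le d_le le_sum eq_sum.
  by exists f.
have mu0 : mu 0%N <= d 0%N by have := le_sum 1%N isT; rewrite !big_ord1.
case: n IHn Df ipf Ef mu_le d_le le_sum eq_sum => [|n'].
  move=> _ Df ipf Ef _ _ _; rewrite !big_ord1 => mud.
  exists f; split=> //.
  - by move=> i i1; apply: sub_hspan; exists i.
  - by move=> i i1; apply: sub_hspan; exists i.
  - by case=> // _; rewrite Ef // mud.
set n := n'.+1 => IHn Df ipf Ef mu_le d_le le_sum eq_sum.
(* Otherwise every target would exceed the largest value, against the equality of the sums. *)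
have mun : d 0%N <= mu n.
  rewrite leNgt; apply/negP => mud.
  suff : \sum_(i < n.+1) mu i < \sum_(i < n.+1) d i by rewrite eq_sum ltxx.
  apply: ltr_sum; first by apply/hasP; exists ord0; rewrite ?mem_index_enum.
  move=> i _; apply: le_lt_trans (_ : mu n < _).
    by apply: mu_le; have := ltn_ord i; lia.
  by apply: lt_le_trans mud _; apply: d_le; have := ltn_ord i; lia.
(* The least [q] with [d 0 <= mu q.+1]; minimality, or [mu0] when [q = 0], gives the lower bound. *)
have [p [pn mup mup1]] : exists p,
    [/\ (p < n)%N, mu p <= d 0%N & d 0%N <= mu p.+1].
  have exq : exists q, d 0%N <= mu q.+1 by exists n'.
  case: (ex_minnP exq) => q dq q_min; exists q; split=> //; first exact: q_min.
  case: q {dq} q_min => // q q_min; rewrite leNgt; apply/negP => /ltW/q_min.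
  by rewrite ltnn.
have pn1 : (p < n.+1)%N by lia.
have p1n1 : (p.+1 < n.+1)%N by lia.
have [u [v []]] : exists u v,
    rotated (f p) (f p.+1) u v (d 0%N) (mu p + mu p.+1 - d 0%N).
  apply: (rotation_to (Df _ pn1) (Df _ p1n1)); rewrite ?ipf ?eqxx //.
  - by rewrite ltn_eqF.
  - exact: Ef.
  - exact: Ef.
  - exact/andP.
move=> [fu fv] [uvp uvp1] [uu vv uv] [Eu Ev].
have orth w j : hspan [set f p; f p.+1] w -> (j < n.+1)%N -> j != p ->
    j != p.+1 -> ip w (f j) = 0.
  move=> fw jn jp jp1; apply: (hspan_orth Hip (T := [set f j]) _ fw).
    by move=> _ _ [] -> ->; rewrite ipf // eq_sym ?(negbTE jp) ?(negbTE jp1).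
  exact: sub_hspan.
(* With [u] set aside for [d 0], [v] takes place [p] and the vectors after [f p.+1] move down by
   one. *)
pose g i := if (i < p)%N then f i else if i == p then v else f i.+1.
pose nu i := if (i < p)%N then mu i else if i == p then mu p + mu p.+1 - d 0%N
             else mu i.+1.
have Hf := hspan_subspace (f @` `I_n.+1).
have sub2 : hspan [set f p; f p.+1] `<=` hspan (f @` `I_n.+1).
  by apply: hspanS => _ [] ->; [exists p|exists p.+1].
have fDsub : hspan (f @` `I_n.+1) `<=` D.
  by apply: hspan_sub => // _ [i /= ? <-]; exact: Df.
have fg i : (i < n)%N -> hspan (f @` `I_n.+1) (g i).
  move=> ni; rewrite /g; case: ifP => ip1.
    by apply: sub_hspan; exists i => //=; lia.
  case: ifP => ip2; first exact: sub2.
  by apply: sub_hspan; exists i.+1.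
have sum_nu_lo m : (m <= p)%N -> \sum_(i < m) nu i = \sum_(i < m) mu i.
  move=> mp; apply: eq_bigr => i _; rewrite /nu ifT //.
  by have := ltn_ord i; lia.
have sum_nu_hi m : (p < m)%N ->
    \sum_(i < m) nu i = \sum_(i < m.+1) mu i - d 0%N.
  elim: m => // m IHm; rewrite ltnS leq_eqVlt => /orP[/eqP <-|pm].
    rewrite big_ord_recr sum_nu_lo //= !big_ord_recr /= /nu ltnn eqxx; lra.
  rewrite big_ord_recr IHm //= [in RHS]big_ord_recr /= /nu.
  by rewrite ltnNge (ltnW pm) /= gtn_eqF //; lra.
have sumdS m : \sum_(i < m) d i.+1 = \sum_(i < m.+1) d i - d 0%N.
  by rewrite big_ord_recl /= addrAC subrr add0r.
have [e [ipe ge eg Ee]] : exists e : nat -> V,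
    [/\ forall i j, (i < n)%N -> (j < n)%N -> ip (e i) (e j) = (i == j)%:R,
        forall i, (i < n)%N -> hspan (g @` `I_n) (e i),
        forall i, (i < n)%N -> hspan (e @` `I_n) (g i) &
        forall i, (i < n)%N -> ip (E (e i)) (e i) = ((d i.+1)%:C)%C].
  apply: (IHn g nu (fun i => d i.+1)).
  - by move=> i ni; apply: fDsub; exact: fg.
  - move=> i j ni nj; rewrite /g.
    have [ip1|ip1] := boolP (i < p)%N; have [jp1|jp1] := boolP (j < p)%N.
    + by apply: ipf; lia.
    + case: ifP => jp2.
        rewrite (_ : i == j = false); last by lia.
        by apply: (ip_sym0 Hip); apply: orth => //; lia.
      by rewrite (_ : (i == j) = (i == j.+1)); [apply: ipf|]; lia.
    + case: ifP => ip2.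
        rewrite (_ : i == j = false); last by lia.
        by apply: orth => //; lia.
      by rewrite (_ : (i == j) = (i.+1 == j)); [apply: ipf|]; lia.
    + case: ifP => ip2; case: ifP => jp2.
      * by rewrite (eqP ip2) (eqP jp2) eqxx.
      * rewrite (_ : i == j = false); last by lia.
        by apply: orth => //; lia.
      * rewrite (_ : i == j = false); last by lia.
        by apply: (ip_sym0 Hip); apply: orth => //; lia.
      * by rewrite ipf.
  - move=> i ni; rewrite /g /nu; case: ifP => ip1; first by rewrite Ef //; lia.
    by case: ifP => // _; rewrite Ef.
  (* Since [d 0] lies between [mu p] and [mu p.+1], so does the new value [mu p + mu p.+1 - d 0]. *)
  - move=> i j /andP[ij nj]; rewrite /nu.
    have ple k : (k <= p)%N -> mu k <= mu p by move=> kp; apply: mu_le; lia.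
    have lep k : (p < k <= n)%N -> mu p.+1 <= mu k.
      by move=> kp; apply: mu_le; lia.
    have [ip1|ip1] := boolP (i < p)%N; have [jp1|jp1] := boolP (j < p)%N;
      try by exfalso; lia.
    + by apply: mu_le; lia.
    + case: ifP => jp2; last by apply: mu_le; lia.
      by have := ple i (ltnW ip1); lra.
    + case: ifP => ip2; case: ifP => jp2 //; try by exfalso; lia.
      * have pj : (p < j.+1 <= n)%N by lia.
        by have := lep _ pj; lra.
      * by apply: mu_le; lia.
  - by move=> i j /andP[ij nj]; apply: d_le; lia.
  (* Up to [p] the comparison is termwise through [d 0]; beyond [p] it is the hypothesis at [m.+1]
     with [d 0] subtracted from both sides. *)
  - move=> m mn; have [mp|pm] := leqP m p.
      rewrite sum_nu_lo //; apply: ler_sum => i _.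
      apply: le_trans (_ : d 0%N <= _).
        by apply: le_trans mup; apply: mu_le; have := ltn_ord i; lia.
      by apply: d_le; have := ltn_ord i; lia.
    by rewrite sum_nu_hi // sumdS lerD2r; apply: le_sum.
  - by rewrite sum_nu_hi // sumdS eq_sum.
pose e' i := if i is i'.+1 then e i' else u.
have He := hspan_subspace (e' @` `I_n.+1).
have ee : hspan (e @` `I_n) `<=` hspan (e' @` `I_n.+1).
  by apply: hspanS => _ [i /= ni <-]; exists i.+1.
have uvsub : hspan [set u; v] `<=` hspan (e' @` `I_n.+1).
  apply: hspan_sub => // _ [] ->; first by apply: sub_hspan; exists 0%N.
  by apply: ee; have := eg p pn; rewrite /g ltnn eqxx.
have ue i : (i < n)%N -> ip u (e i) = 0.
  move=> ni; apply: (hspan_orth Hip (S := [set u]) _ _ (ge i ni)); last first.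
    exact: sub_hspan.
  move=> _ _ -> [j /= nj <-]; rewrite /g.
  case: ifP => jp1; first by apply: orth => //; lia.
  by case: ifP => jp2 //; apply: orth => //; lia.
exists e'; split.
- case=> [|i] [|j] //= ni nj.
  + exact: ue.
  + by apply: (ip_sym0 Hip); exact: ue.
  + exact: ipe.
- case=> [|i] ni /=; first exact: sub2.
  by apply: (hspan_sub Hf _ (ge i ni)) => _ [j /= nj <-]; exact: fg.
- move=> i ni; have [ip1|pi|->] := ltngtP i p; last exact: uvsub.
    have := ee _ (eg i _); rewrite /g ip1; apply; lia.
  have [->|ip1] := eqVneq i p.+1; first exact: uvsub.
  have := ee _ (eg i.-1 _); rewrite /g ifF; last by lia.
  by rewrite ifF ?prednK; [apply|..]; lia.
- by case=> [|i] ni //=; exact: Ee.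
Qed.

(* A residual vector [g j] with value [nu j - C j] is carried along. Rotating
   it against [h j.+1] raises its value by [C j.+1] and leaves the residual
   [g j.+1]. The gap hypothesis bounds the squared coefficient of [g j.+1] in
   [g j] by 1/2, so that the residuals fade away from the closed span. *)
Lemma raise_chain (h : nat -> V) (nu C : nat -> R) :
  (forall i, D (h i)) -> horthonormal ip h ->
  (forall i, ip (E (h i)) (h i) = ((nu i)%:C)%C) ->
  C 0%N = 0 -> (forall j, 0 <= C j) ->
  (forall j, 2 * C j.+1 <= nu j.+1 - nu j + C j) ->
  exists e : nat -> V,
    [/\ horthonormal ip e, forall i, lspan h (e i), forall i, cspan ip e (h i) &
        forall i, ip (E (e i)) (e i) = ((nu i - C i + C i.+1)%:C)%C].
Proof.
move=> Dh oh Eh C0 C_ge0 gap.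
pose P j g := [/\ ip g g = 1, hspan (h @` `I_j.+1) g &
  ip (E g) g = ((nu j - C j)%:C)%C].
pose Step j g u v :=
  rotated g (h j.+1) u v (nu j - C j + C j.+1) (nu j.+1 - C j.+1) /\
  exists c s : R, g = (c%:C)%C *: u + (s%:C)%C *: v /\ s ^+ 2 <= 2^-1.
have DP j g : hspan (h @` `I_j) g -> D g.
  by apply: hspan_sub => // _ [i _ <-].
have gh j g k : (j <= k)%N -> hspan (h @` `I_j) g -> ip g (h k) = 0.
  move=> jk hg; apply: (hspan_orth Hip (T := [set h k]) _ hg).
    by move=> _ _ [i /= ij <-] ->; rewrite oh ltn_eqF //; lia.
  exact: sub_hspan.
have step_ex j g : P j g -> exists u v, Step j g u v.
  (* This [t] raises the residual value [x] by exactly [C j.+1], and the gap gives [t <= 1/2]. A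
     zero denominator forces [C j.+1 = 0], and then [t] is 0 by convention. *)
  move=> [gg hg Eg]; set x := nu j - C j; pose t := C j.+1 / (nu j.+1 - x).
  have xE : nu j.+1 - x = nu j.+1 - nu j + C j by rewrite /x; lra.
  have := gap j; rewrite -xE => gapj.
  have := C_ge0 j.+1 => Cj.
  have tC : t * (nu j.+1 - x) = C j.+1.
    have [x0|xn0] := eqVneq (nu j.+1 - x) 0; last by rewrite /t divfK.
    by rewrite x0 mulr0; move: gapj; rewrite x0; lra.
  have t0 : 0 <= t by rewrite /t divr_ge0 //; lra.
  have t1 : t <= 2^-1.
    have [x0|xn0] := eqVneq (nu j.+1 - x) 0.
      by rewrite /t x0 invr0 mulr0 invr_ge0 ler0n.
    have xpos : 0 < nu j.+1 - x by rewrite lt_neqAle eq_sym xn0 /=; lra.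
    by rewrite ler_pdivrMr //; lra.
  have t01 : 0 <= t <= 1 by rewrite t0 /=; lra.
  have [u [v [ruv [c [s [guv s2]]]]]] :=
    rotation (DP _ _ hg) (Dh j.+1) gg
      (etrans (oh _ _) (congr1 _ (congr1 nat_of_bool (eqxx j.+1))))
      (gh _ _ _ (leqnn _) hg) Eg (Eh j.+1) t01.
  exists u, v; split; last by exists c, s; rewrite s2.
  by congr (rotated _ _ _ _ _ _): ruv; rewrite -/x; move: tC;
    rewrite mulrBr mulrBl mul1r; lra.
(* A total step function is needed for the recursion; outside the invariant [P] it returns the dummy
   pair [(0, 0)]. *)
have [st stP] : {st : nat * V -> V * V & forall y : nat * V,
    P y.1 y.2 -> Step y.1 y.2 (st y).1 (st y).2}.
  apply: (choice (P := fun y z : _ * V =>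
    P y.1 y.2 -> Step y.1 y.2 z.1 z.2)) => -[j g] /=.
  have [Pg|nPg] := pselect (P j g).
    by have [u [v uv]] := step_ex _ _ Pg; exists (u, v).
  by exists (0, 0).
pose G := fix G j := if j is j'.+1 then (st (j', G j')).2 else h 0%N.
pose e j := (st (j, G j)).1.
have sub2 j : hspan (h @` `I_j.+1) (G j) ->
    hspan [set G j; h j.+1] `<=` hspan (h @` `I_j.+2).
  move=> hG; apply: hspan_sub; first exact: hspan_subspace.
  move=> _ [] ->; last by apply: sub_hspan; exists j.+1 => /=.
  by apply: hspanS hG => _ [i /= ij <-]; exists i => //=; lia.
have PG j : P j (G j).
  elim: j => [|j IHj].
    split; first by rewrite oh.
      by apply: sub_hspan; exists 0%N.
    by rewrite Eh C0 subr0.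
  have [[[hu hv] _ [uu vv uv] [Eu Ev]] _] := stP (j, G j) IHj.
  by split=> //; apply: (sub2 j) => //; case: IHj.
have SG j : Step j (G j) (e j) (G j.+1) by exact: (stP (j, G j) (PG j)).
have eG i j : (i < j)%N -> ip (e i) (G j) = 0.
  elim: j => // j IHj; rewrite ltnS leq_eqVlt => /orP[/eqP ->|ij].
    by have [[_ _ [_ _ ->]]] := SG j.
  have [[[_ hv] _ _ _] _] := SG j.
  apply: (hspan_orth Hip (S := [set e i]) _ _ hv); last exact: sub_hspan.
  move=> _ _ -> [] ->; first exact: IHj.
  have [[[hu _] _ _ _] _] := SG i.
  (* [e i] involves only [h 0] to [h i.+1], so it is orthogonal to [h k] for [k >= i.+2]. *)
  by apply: (gh i.+2) => //; apply: (sub2 i) => //; case: (PG i).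
have eltn i j : (i < j)%N -> ip (e i) (e j) = 0.
  move=> ij; have [[[hu _] _ _ _] _] := SG j.
  apply: (hspan_orth Hip (S := [set e i]) _ _ hu); last exact: sub_hspan.
  move=> _ _ -> [] ->; first exact: eG.
  have [[[hu' _] _ _ _] _] := SG i.
  by apply: (gh i.+2) => //; apply: (sub2 i) => //; case: (PG i).
have He := hspan_subspace (range e).
(* Unrolling [G j] into [e j] and [G j.+1] multiplies the squared error by at most 1/2; the initial
   error is the unit norm of [G j]. *)
have approx n j : exists y, hspan (range e) y /\ sqn ip (G j - y) <= 2^-1 ^+ n.
  elim: n j => [|n IHn] j.
    exists 0; split; first by case: He.
    by rewrite subr0 expr0 /sqn; have [-> _ _] := PG j.
  have [_ [c [s [GE s2]]]] := SG j; have [y [ey Gy]] := IHn j.+1.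
  exists ((c%:C)%C *: e j + (s%:C)%C *: y); split.
    apply: (subspaceD He); apply: (subspaceZ _ He) => //.
    by apply: sub_hspan; exists j.
  rewrite {1}GE opprD addrACA subrr add0r -scalerBr (sqnZ Hip) /= expr0n addr0.
  by rewrite [leRHS]exprS ler_pM // ?sqr_ge0 ?sqn_ge0.
have Gcl j : cspan ip e (G j).
  apply/(hclosureP Hip) => eps eps0.
  have [n nlt] : exists n, 2^-1 ^+ n < eps.
    exists (Num.bound eps^-1); rewrite exprVn -[ltRHS]invrK ltf_pV2 ?posrE.
    - exact: upper_nthrootP.
    - by rewrite exprn_gt0.
    - by rewrite invr_gt0.
  have [y [ey Gy]] := approx n j.
  by exists y; split; [rewrite lspanE|exact: le_lt_trans nlt].
have Hcl : is_subspace (cspan ip e).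
  by apply: (hclosure_subspace Hip); exact: lspan_subspace.
exists e; split.
- move=> i j; have [ij|ji|->] := ltngtP i j.
  + exact: eltn.
  + by apply: (ip_sym0 Hip); exact: eltn.
  + by have [[_ _ [-> _ _]]] := SG j.
- move=> i; rewrite lspanE; have [[[hu _] _ _ _] _] := SG i.
  apply: (hspanS _ (sub2 i _ _ hu)); last by case: (PG i).
  by move=> _ [k _ <-]; exists k.
- case=> [|j]; first exact: Gcl 0%N.
  have [[_ [_ hj] _ _] _] := SG j.
  apply: (hspan_sub Hcl _ hj) => _ [] ->; last exact: Gcl.
  by apply: (sub_hclosure Hip); exact: mem_lspan.
- by move=> i; have [[_ _ _ [-> _]]] := SG i.
Qed.

(* [S (a j)] is the surplus accumulated before block [j]. [raise_chain] moves
   it into the last vector of each block, after which every block separately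
   satisfies the finite majorization condition. *)
Lemma horn_of_blocks (d lam : nat -> R) (f : nat -> V) (a : nat -> nat) :
  let S m := \sum_(i < m) (d i - lam i) in
  nondecr_seq d -> nondecr_seq lam ->
  a 0%N = 0%N -> (forall j, (a j < a j.+1)%N) ->
  (forall j m, (a j <= m)%N -> S (a j) <= S m) ->
  (forall j, lam (a j).-1 + 2 * S (a j) <= lam (a j.+1).-1) ->
  (forall i, D (f i)) -> horthonormal ip f ->
  (forall i, ip (E (f i)) (f i) = ((lam i)%:C)%C) ->
  exists e : nat -> V,
    [/\ horthonormal ip e, forall i, lspan f (e i), cspan ip e = cspan ip f &
        forall i, ip (E (e i)) (e i) = ((d i)%:C)%C].
Proof.
move=> S d_le lam_le a0 a_lt S_min lam_gap Df of_ Ef.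
have [blk blkP] := block_index a0 a_lt.
have blk_bounds i : (a (blk i) <= i < a (blk i).+1)%N by rewrite blkP.
pose l j := (a j.+1).-1.
have l_bounds j : (a j <= l j < a j.+1)%N by have := a_lt j; rewrite /l; lia.
have blk_l j : blk (l j) = j by apply/eqP; rewrite -blkP.
have l_inj i j : (l i == l j) = (i == j).
  by apply/eqP/eqP => [ij|->//]; rewrite -(blk_l i) ij.
pose C j := S (a j).
have C0 : C 0%N = 0 by rewrite /C /S a0 big_ord0.
have C_ge0 j : 0 <= C j by rewrite -C0; apply: S_min; rewrite a0.
have C_le j : C j <= C j.+1 by apply: S_min; exact: ltnW.
have gap j : 2 * C j.+1 <= lam (l j.+1) - lam (l j) + C j.
  by have := lam_gap j.+1; have := C_ge0 j; rewrite /C /l; lra.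
have oh : horthonormal ip (f \o l) by move=> i j; rewrite /= of_ l_inj.
have [r [or lr cr Er]] := raise_chain (fun i => Df (l i)) oh
  (fun i => Ef (l i)) C0 C_ge0 gap.
(* Only the last vector of each block changes; its value rises by the increase of the surplus over
   the block. *)
pose g i := if i == l (blk i) then r (blk i) else f i.
pose mu i := lam i + (if i == l (blk i) then C (blk i).+1 - C (blk i) else 0).
have lspan_r i : lspan f (r i).
  have := lr i; rewrite !lspanE; apply: hspanS => _ [k _ <-].
  by exists (l k).
have lspan_g i : lspan f (g i).
  by rewrite /g; case: ifP => _; [exact: lspan_r|exact: mem_lspan].
have lspanD : lspan f `<=` D.
  by rewrite lspanE; apply: hspan_sub => // _ [i _ <-].
have Dg i : D (g i) by apply: lspanD.
have rf i k : k != l (blk k) -> ip (r i) (f k) = 0.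
  move=> kl; have := lr i; rewrite lspanE => ri.
  apply: (hspan_orth Hip (T := [set f k]) _ ri); last exact: sub_hspan.
  move=> _ _ [j _ <-] ->; rewrite /= of_.
  by case: eqP => // jk; rewrite -jk blk_l eqxx in kl.
have og : horthonormal ip g.
  move=> i k; rewrite /g; have [il|il] := eqVneq i (l (blk i));
    have [kl|kl] := eqVneq k (l (blk k)).
  - by rewrite or {2}il {2}kl l_inj.
  - rewrite rf //; case: eqP => // ik; by rewrite -ik -il eqxx in kl.
  - rewrite (ip_sym0 Hip (rf _ _ il)); case: eqP => // ik.
    by rewrite ik -kl eqxx in il.
  - exact: of_.
have Eg i : ip (E (g i)) (g i) = ((mu i)%:C)%C.
  rewrite /g /mu; case: eqP => [il|_]; last by rewrite Ef addr0.
  by rewrite Er -il; congr (_ %:C)%C; lra.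
have sum_shift p m :
    \sum_(i < m) d (p + i)%N = \sum_(i < m) lam (p + i)%N + (S (p + m)%N - S p).
  elim: m => [|m IHm]; first by rewrite !big_ord0 addn0; lra.
  by rewrite !big_ord_recr /= IHm addnS /S big_ord_recr /=; lra.
have blk_in j i : (i < a j.+1 - a j)%N -> blk (a j + i)%N = j.
  by move=> ni; apply/eqP; rewrite -blkP; lia.
have mu_lo j i : (i.+1 < a j.+1 - a j)%N -> mu (a j + i)%N = lam (a j + i)%N.
  move=> ni; rewrite /mu blk_in; last by lia.
  by rewrite ifF ?addr0 // /l; lia.
have mu_hi j : mu (l j) = lam (l j) + (C j.+1 - C j) by rewrite /mu blk_l eqxx.
have sum_lo j m : (m < a j.+1 - a j)%N ->
    \sum_(i < m) mu (a j + i)%N = \sum_(i < m) lam (a j + i)%N.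
  by move=> mn; apply: eq_bigr => i _; apply: mu_lo; have := ltn_ord i; lia.
have sum_hi j : \sum_(i < a j.+1 - a j) mu (a j + i)%N =
    \sum_(i < a j.+1 - a j) d (a j + i)%N.
  rewrite sum_shift subnKC ?(ltnW (a_lt j)) //.
  have [n nE] : exists n, (a j.+1 - a j = n.+1)%N.
    by exists (a j.+1 - a j).-1; have := a_lt j; lia.
  rewrite nE !big_ord_recr /= -sum_lo ?nE //.
  have -> : (a j + n)%N = l j by rewrite /l; lia.
  by rewrite mu_hi addrA.
have block j : exists e : nat -> V,
    [/\ forall i k, (i < a j.+1 - a j)%N -> (k < a j.+1 - a j)%N ->
          ip (e i) (e k) = (i == k)%:R,
        forall i, (i < a j.+1 - a j)%N ->
          hspan ((fun i => g (a j + i)%N) @` `I_(a j.+1 - a j)) (e i),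
        forall i, (i < a j.+1 - a j)%N ->
          hspan (e @` `I_(a j.+1 - a j)) (g (a j + i)%N) &
        forall i, (i < a j.+1 - a j)%N ->
          ip (E (e i)) (e i) = ((d (a j + i)%N)%:C)%C].
  apply: (horn_finite (mu := fun i => mu (a j + i)%N)) => //.
  - by move=> i k _ _; rewrite og eqn_add2l.
  (* Only the last value of the block is altered, and by [C_le] it can only grow, so the order
     survives. *)
  - move=> i k /andP[ik kn].
    have lam_ik : lam (a j + i)%N <= lam (a j + k)%N by apply: lam_le; lia.
    have [kn'|kn'] := ltnP k.+1 (a j.+1 - a j).
      by rewrite !mu_lo //; lia.
    have [->//|ik'] := eqVneq i k; rewrite mu_lo; last by lia.
    have kl : (a j + k)%N = l j by rewrite /l; lia.
    by move: lam_ik; rewrite kl mu_hi; have := C_le j; lra.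
  - by move=> i k /andP[ik kn]; apply: d_le; lia.
  (* On a proper initial segment the excess of [d] is [S (a j + m) - S (a j)], nonnegative by
     [S_min]; on the whole block the raise turns it into equality. *)
  - move=> m; rewrite leq_eqVlt => /orP[/eqP->|mn]; first by rewrite sum_hi.
    rewrite sum_lo // sum_shift lerDl subr_ge0; apply: S_min; lia.
have [eb ebP] := choice block.
pose e i := eb (blk i) (i - a (blk i))%N.
have eE j i : (i < a j.+1 - a j)%N -> e (a j + i)%N = eb j i.
  by move=> ni; rewrite /e blk_in // addKn.
have in_blk i : (i - a (blk i) < a (blk i).+1 - a (blk i))%N.
  by have := blk_bounds i; lia.
have blkK i : (a (blk i) + (i - a (blk i)))%N = i by have := blk_bounds i; lia.
have lspan_e i : lspan f (e i).
  have [_ ge _ _] := ebP (blk i).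
  apply: (hspan_sub (lspan_subspace f) _ (ge _ (in_blk i))).
  by move=> _ [k _ <-]; exact: lspan_g.
have cspan_sub : is_subspace (cspan ip e).
  by apply: (hclosure_subspace Hip); exact: lspan_subspace.
have cspan_g i : cspan ip e (g i).
  have [_ _ eg _] := ebP (blk i); have := eg _ (in_blk i); rewrite blkK.
  apply: hspan_sub => // _ [k /= nk <-]; rewrite -eE //.
  by apply: (sub_hclosure Hip); exact: mem_lspan.
(* A block's last [f i] lies only in the closed span of the [r j]. These are values of [g], hence in
   [cspan ip e], and closing twice adds nothing. *)
have cspan_f i : cspan ip e (f i).
  have [il|il] := eqVneq i (l (blk i)); last first.
    by have := cspan_g i; rewrite /g (negbTE il).
  apply: (hclosure_idem Hip).
  have := cr (blk i); rewrite /= -il; apply: hclosureS.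
  rewrite lspanE; apply: hspan_sub => // _ [k _ <-].
  by have := cspan_g (l k); rewrite /g blk_l eqxx.
exists e; split=> //.
(* Inside a block the finite theorem applies; distinct blocks are spanned by disjoint parts of the
   orthonormal [g]. *)
- move=> i k; have [ik|ik] := eqVneq (blk i) (blk k).
    have [oe _ _ _] := ebP (blk i); have := oe _ _ (in_blk i).
    rewrite {1 2 5}ik /e => -> //; rewrite ?ik //; congr ((nat_of_bool _)%:R).
    by have := blk_bounds i; have := blk_bounds k; rewrite ik; lia.
  have -> : i == k = false by apply/eqP => ik'; rewrite ik' eqxx in ik.
  have [_ ge _ _] := ebP (blk i); have [_ ge' _ _] := ebP (blk k).
  apply: (hspan_orth Hip _ (ge _ (in_blk i)) (ge' _ (in_blk k))).
  move=> _ _ [p /= pn <-] [q /= qn <-]; rewrite og.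
  case: eqP => // pq; have := blk_in _ _ pn; rewrite pq blk_in // => ki.
  by rewrite ki eqxx in ik.
- apply/seteqP; split.
    apply: hclosureS; rewrite lspanE; apply: hspan_sub => //.
      exact: lspan_subspace.
    by move=> _ [i _ <-].
  apply: subset_trans (hclosure_idem Hip (A := lspan e)).
  apply: hclosureS; rewrite (lspanE f); apply: (hspan_sub cspan_sub).
  by move=> _ [i _ <-]; exact: cspan_f.
- move=> i; have [_ _ _ Ee] := ebP (blk i).
  by rewrite /e Ee // blkK.
Qed.

End Operator.

Theorem theorem4p3 (R : realType) (V : lmodType R[i]) (ip : V -> V -> R[i])
  (D : set V) (E : V -> V) (d lam : nat -> R) (f : nat -> V) :
  is_hilbert ip ->
  is_subspace D -> hdense ip D ->
  hsymmetric_op ip D E ->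
  nondecr_seq d -> unbounded_seq d ->
  nondecr_seq lam -> unbounded_seq lam ->
  (forall k : nat, 0 <= delta d lam k) ->
  (forall N : nat, exists k : nat, (N <= k)%N /\
     ((delta d lam k)%:E < limn_einf (fun i => (delta d lam i)%:E))%E) ->
  (forall i : nat, D (f i)) ->
  horthonormal ip f ->
  (forall i : nat, ip (E (f i)) (f i) = ((lam i)%:C)%C) ->
  exists e : nat -> V,
    [/\ horthonormal ip e,
        (forall i : nat, lspan f (e i)),
        cspan ip e = cspan ip f &
        (forall i : nat, ip (E (e i)) (e i) = ((d i)%:C)%C)].
Proof.
move=> [Hip _] HD _ HE d_le _ lam_le lam_unb delta_ge0 delta_lt Df of_ Ef.
have [a [a0 a_lt S_min lam_gap]] :=
  block_decomposition lam_le lam_unb delta_ge0 (liminf_tail_min delta_lt).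
exact: (horn_of_blocks Hip HD HE d_le lam_le a0 a_lt S_min lam_gap Df of_ Ef).
Qed.
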